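(* Let $N\ge 2$ and let $A\in M_N(\mathbb{C})$ be such that $A$ is not a scalar multiple of the identity matrix $I$ and $\sigma(A)\cap\partial W(A)\neq\emptyset$. If $A_n\to A$ in $M_N(\mathbb{C})$, then $\limsup_{n\to\infty}\psi(A_n)\le C_{N-1}$, where $C_{N-1}:=\sup\{\psi(B): B\in M_{N-1}(\mathbb{C})\}$.
   Context: $M_N(\mathbb{C})$ denotes the algebra of complex $N\times N$ matrices acting on $\mathbb{C}^N$ with the Euclidean inner product, equipped with the operator norm. $\sigma(A)$ is the spectrum of $A$. The numerical range is $W(A):=\{\langle Ax,x\rangle: \|x\|=1\}$ and $\partial W(A)$ is its boundary in $\mathbb{C}$. The Crouzeix ratio of a matrix $B$ is $\psi(B):=\sup\{\|p(B)\|: p \text{ a polynomial with } |p|\le 1 \text{ on } W(B)\}$. *)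

(* Defs.v *)
From HB Require Import structures.
From mathcomp Require Import all_boot all_order all_algebra.
From mathcomp Require Import all_classical all_reals all_analysis.
From mathcomp Require Import complex.
Set Implicit Arguments.
Unset Strict Implicit.
Unset Printing Implicit Defensive.
Import Order.TTheory GRing.Theory Num.Theory.
Import numFieldNormedType.Exports.
Local Open Scope ring_scope.
Local Open Scope classical_set_scope.

Notation normc := ComplexField.Normc.normc.

Definition cinner (R : realType) (N : nat) (x y : 'cV[R[i]]_N) : R[i] :=
  \sum_(i < N) x i 0 * (y i 0)^*.

Definition cvnorm (R : realType) (N : nat) (x : 'cV[R[i]]_N) : R :=
  Num.sqrt (\sum_(i < N) normc (x i 0) ^+ 2).

Definition unit_sphere (R : realType) (N : nat) : set 'cV[R[i]]_N :=
  [set x | cvnorm x = 1].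

Definition opnorm (R : realType) (N : nat) (A : 'M[R[i]]_N) : R :=
  sup [set cvnorm (A *m x) | x in @unit_sphere R N].

Definition num_range (R : realType) (N : nat) (A : 'M[R[i]]_N) : set R[i] :=
  [set cinner (A *m x) x | x in @unit_sphere R N].

Definition spectrum (R : realType) (N : nat) (A : 'M[R[i]]_N) : set R[i] :=
  [set z | (A - z%:M) \notin unitmx].

(* Topological boundary of a subset of C, for the usual (modulus) topology
   of C: closure minus interior, written with open discs explicitly since
   R[i] carries no topology instance in the library. *)
Definition cclosure (R : realType) (S : set R[i]) : set R[i] :=
  [set z | forall e : R, 0 < e -> exists2 w, S w & normc (w - z) < e].
Definition cinterior (R : realType) (S : set R[i]) : set R[i] :=
  [set z | exists2 e : R, 0 < e & forall w, normc (w - z) < e -> S w].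
Definition cboundary (R : realType) (S : set R[i]) : set R[i] :=
  cclosure S `\` cinterior S.

(* Crouzeix ratio psi(B) = sup { ||p(B)|| : p polynomial, |p| <= 1 on W(B) },
   valued in the extended reals. Matrices of size n.+1 (horner_mx needs it). *)
Definition crouzeix_ratio (R : realType) (n : nat) (B : 'M[R[i]]_n.+1) : \bar R :=
  ereal_sup [set (opnorm (horner_mx B p))%:E | p in
     [set p : {poly R[i]} | forall z, num_range B z -> normc p.[z] <= 1]].

Definition crouzeix_const (R : realType) (n : nat) : \bar R :=
  ereal_sup [set crouzeix_ratio B | B in [set: 'M[R[i]]_n.+1]].

(* Main.v *)
(* Let l be an eigenvalue of A on the boundary of W(A).  Then
   ker(A - l) = ker(A - l)^*, for otherwise a perturbation of the Rayleigh
   quotient at an eigenvector would cover a neighbourhood of l.  Let P be the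
   orthogonal projection onto ker(A - l); it is neither 0 nor 1.  For T near A
   split char_poly T = q r, where q collects the roots near l; then ker q(T) is
   almost contained in the range of P and ker r(T) almost in its kernel, so
   these complementary T-invariant subspaces are proper and almost orthogonal.
   On a proper invariant subspace p(T) agrees with p(D), where D is the
   compression of T to a hyperplane; since W(D) is contained in W(T), p(T) is
   bounded by C_{N-1} there, and hence on the whole space up to a factor
   close to 1. *)

Require Import Defs.
From HB Require Import structures.
From mathcomp Require Import all_boot all_order all_algebra.
From mathcomp Require Import all_classical all_reals all_analysis.
From mathcomp Require Import complex spectral ring lra.
Set Implicit Arguments.
Unset Strict Implicit.
Unset Printing Implicit Defensive.
Import Order.TTheory GRing.Theory Num.Theory.
Import numFieldNormedType.Exports ComplexField.Normc.
Local Open Scope ring_scope.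
Local Open Scope classical_set_scope.

Local Notation "M ^H" := (map_mx Num.conj (trmx M)) (at level 8, format "M ^H").

(** * Inner product, norm, isometries and operator norm on complex column vectors *)

Section HermitianSpace.
Variable R : realType.
Implicit Types (x y z : R[i]).

Lemma normc_normr z : (normc z)%:C%C = `|z|.
Proof. by []. Qed.

Lemma normc_ge0 z : 0 <= normc z.
Proof. by rewrite -ler0c normc_normr. Qed.

Lemma normc_sqr z : ((normc z) ^+ 2)%:C%C = z * z^*.
Proof. by rewrite rmorphXn /= normc_normr normCK. Qed.

Lemma normc_real (a : R) : normc a%:C%C = `|a|.
Proof. by rewrite /= expr0n addr0 sqrtr_sqr. Qed.

Section Vectors.
Variable N : nat.
Implicit Types (u v w : 'cV[R[i]]_N) (A B : 'M[R[i]]_N).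

Lemma cinner_mx u v : cinner u v = (v^H *m u) 0 0.
Proof.
by rewrite /cinner mxE; apply: eq_bigr => j _; rewrite !mxE mulrC.
Qed.

Lemma cinnerDl u v w : cinner (u + v) w = cinner u w + cinner v w.
Proof. by rewrite !cinner_mx mulmxDr mxE. Qed.

Lemma cinnerZl a u v : cinner (a *: u) v = a * cinner u v.
Proof. by rewrite !cinner_mx -scalemxAr mxE. Qed.

Lemma cinner_conj u v : (cinner u v)^* = cinner v u.
Proof.
by rewrite rmorph_sum; apply: eq_bigr => j _; rewrite rmorphM /= conjCK mulrC.
Qed.

Lemma cinnerDr u v w : cinner u (v + w) = cinner u v + cinner u w.
Proof. by rewrite -cinner_conj cinnerDl rmorphD /= !cinner_conj. Qed.

Lemma cinnerZr a u v : cinner u (a *: v) = a^* * cinner u v.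
Proof. by rewrite -cinner_conj cinnerZl rmorphM /= cinner_conj. Qed.

Lemma cinner0l v : cinner 0 v = 0.
Proof. by rewrite cinner_mx mulmx0 mxE. Qed.

Lemma cvnorm_ge0 u : 0 <= cvnorm u.
Proof. exact: sqrtr_ge0. Qed.

Lemma cvnorm_sqr u : cvnorm u ^+ 2 = \sum_(j < N) normc (u j 0) ^+ 2.
Proof. by rewrite sqr_sqrtr // sumr_ge0 // => j _; rewrite sqr_ge0. Qed.

Lemma cinner_norm u : cinner u u = (cvnorm u ^+ 2)%:C%C.
Proof.
rewrite cvnorm_sqr [RHS]rmorph_sum; apply: eq_bigr => j _.
by rewrite -normc_sqr.
Qed.

Lemma cvnorm_eq0 u : (cvnorm u == 0) = (u == 0).
Proof.
apply/eqP/eqP => [u0|->]; last first.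
  by rewrite /cvnorm big1 ?sqrtr0 // => j _; rewrite mxE normc0 expr0n.
have /eqP : \sum_(j < N) normc (u j 0) ^+ 2 = 0.
  by rewrite -cvnorm_sqr u0 expr0n.
rewrite psumr_eq0; last by move=> j _; rewrite sqr_ge0.
move=> /allP H; apply/matrixP => j k; rewrite (ord1 k) mxE.
apply: eq0_normc; apply/eqP; rewrite -sqrf_eq0.
by have := H j (mem_index_enum _).
Qed.

Lemma cvnorm_gt0 u : (0 < cvnorm u) = (u != 0).
Proof. by rewrite lt0r cvnorm_ge0 andbT cvnorm_eq0. Qed.

Lemma cvnorm0 : cvnorm (0 : 'cV[R[i]]_N) = 0.
Proof. by apply/eqP; rewrite cvnorm_eq0. Qed.

Lemma cvnormZ a u : cvnorm (a *: u) = normc a * cvnorm u.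
Proof.
apply/eqP; rewrite -(@eqrXn2 _ 2) ?mulr_ge0 ?cvnorm_ge0 ?normc_ge0 //.
apply/eqP/complexI; rewrite -cinner_norm cinnerZl cinnerZr cinner_norm mulrA.
by rewrite -normc_sqr -rmorphM exprMn.
Qed.

Lemma cvnormN u : cvnorm (- u) = cvnorm u.
Proof. by rewrite -scaleN1r cvnormZ normcN normc1 mul1r. Qed.

(** Cauchy-Schwarz, transported from the form [dotmx] on row vectors; hence the transposes. *)
Lemma cinner_le u v : normc (cinner u v) <= cvnorm u * cvnorm v.
Proof.
have -> : cinner u v = dotmx u^T v^T.
  by rewrite dotmxE mxE; apply: eq_bigr => j _; rewrite !mxE.
have nE w : dotmx w^T w^T = (cvnorm w ^+ 2)%:C%C.
  rewrite -cinner_norm dotmxE mxE; apply: eq_bigr => j _.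
  by rewrite !mxE.
rewrite -(@ler_pXn2r _ 2) ?nnegrE ?mulr_ge0 ?cvnorm_ge0 ?normc_ge0 //.
have : `|dotmx u^T v^T| ^+ 2 <= dotmx u^T u^T * dotmx v^T v^T.
  by have [] := CauchySchwarz (@dotmx R[i] N) u^T v^T.
by rewrite !nE -normc_normr -rmorphXn -rmorphM lecR exprMn.
Qed.

Lemma cvnormD u v : cvnorm (u + v) <= cvnorm u + cvnorm v.
Proof.
rewrite -(@ler_pXn2r _ 2) ?nnegrE ?addr_ge0 ?cvnorm_ge0 //.
rewrite -lecR -cinner_norm cinnerDl !cinnerDr !cinner_norm.
have -> : cinner v u = (cinner u v)^* by rewrite cinner_conj.
have := cinner_le u v; case: (cinner u v) => a b /= H.
rewrite addrACA addrA.
set s := (X in X <= _).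
have -> : s = (cvnorm u ^+ 2 + 2 * a + cvnorm v ^+ 2)%:C%C.
  apply/eqP; rewrite /s eq_complex /=; apply/andP; split; apply/eqP; ring.
rewrite lecR.
have : a <= Num.sqrt (a ^+ 2 + b ^+ 2).
  apply: le_trans (ler_norm a) _; rewrite -sqrtr_sqr ler_wsqrtr //.
  by rewrite lerDl sqr_ge0.
move=> /le_trans /(_ H) H2; rewrite sqrrD lerD2r lerD2l.
by rewrite mulr_natl ler_wMn2r.
Qed.

Lemma cvnormB u v : cvnorm (u - v) <= cvnorm u + cvnorm v.
Proof. by rewrite -[cvnorm v]cvnormN; apply: cvnormD. Qed.

Lemma cvnorm_normalize u : u != 0 ->
  @unit_sphere R N (((cvnorm u)^-1)%:C%C *: u).
Proof.
rewrite -cvnorm_gt0 => u0; rewrite /unit_sphere /= cvnormZ normc_real.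
by rewrite ger0_norm ?invr_ge0 ?cvnorm_ge0 // mulVf // gt_eqF.
Qed.

Lemma cvnorm_sum (I : finType) (F : I -> 'cV[R[i]]_N) :
  cvnorm (\sum_j F j) <= \sum_j cvnorm (F j).
Proof.
elim/big_ind2: _ => // [|x x' y y' H H']; first by rewrite cvnorm0.
by apply: le_trans (cvnormD _ _) _; apply: lerD.
Qed.

End Vectors.

Lemma cinner_adj m N (A : 'M[R[i]]_(m, N)) u v :
  cinner (A *m u) v = cinner u (A^H *m v).
Proof.
rewrite !cinner_mx trmx_mul map_mxM map_trmx trmxK -map_mx_comp mulmxA.
rewrite (_ : map_mx _ A = A) //.
by apply/matrixP => j k; rewrite mxE /= conjCK.
Qed.

Lemma adjK m N (A : 'M[R[i]]_(m, N)) : (A^H)^H = A.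
Proof. by apply/matrixP => j k; rewrite !mxE conjCK. Qed.

Lemma adjM m N p (A : 'M[R[i]]_(m, N)) (B : 'M[R[i]]_(N, p)) :
  (A *m B)^H = B^H *m A^H.
Proof. by rewrite trmx_mul map_mxM. Qed.

Lemma cinner_isometry m N (J : 'M[R[i]]_(m, N)) u v :
  J^H *m J = 1%:M -> cinner (J *m u) (J *m v) = cinner u v.
Proof. by move=> JJ; rewrite cinner_adj mulmxA JJ mul1mx. Qed.

Lemma cvnorm_isometry m N (J : 'M[R[i]]_(m, N)) u :
  J^H *m J = 1%:M -> cvnorm (J *m u) = cvnorm u.
Proof.
move=> JJ; apply/eqP; rewrite -(@eqrXn2 _ 2) ?cvnorm_ge0 //.
by apply/eqP/complexI; rewrite -!cinner_norm cinner_isometry.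
Qed.

(** With [w = J^H v], [|w|^2 = <v, J w> <= |v| |J w| = |v| |w|]; divide by [|w|]. *)
Lemma cvnorm_coisometry m N (J : 'M[R[i]]_(m, N)) v :
  J^H *m J = 1%:M -> cvnorm (J^H *m v) <= cvnorm v.
Proof.
move=> JJ; set w := J^H *m v.
have [->|w0] := eqVneq w 0; first by rewrite cvnorm0 cvnorm_ge0.
rewrite -(@ler_pM2r _ (cvnorm w)) ?cvnorm_gt0 // -expr2.
have := cinner_le v (J *m w); rewrite cvnorm_isometry //.
have -> : cinner v (J *m w) = cinner w w.
  by rewrite {2}/w cinner_adj adjK.
by rewrite cinner_norm normc_real ger0_norm // sqr_ge0.
Qed.

Section OperatorNorm.
Variable n : nat.
Implicit Types (A B : 'M[R[i]]_n.+1) (u v : 'cV[R[i]]_n.+1).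

Lemma unit_sphere_nonempty : @unit_sphere R n.+1 !=set0.
Proof.
have h : (const_mx 1 : 'cV[R[i]]_n.+1) != 0.
  by apply/eqP => /matrixP /(_ 0 0); rewrite !mxE => /eqP; rewrite oner_eq0.
by exists (((cvnorm (const_mx 1 : 'cV[R[i]]_n.+1))^-1)%:C%C *: const_mx 1);
   exact: cvnorm_normalize.
Qed.

(** [A *m u] combines the columns of [A] with coefficients of modulus at most [cvnorm u]. This crude
    bound makes the supremum in [opnorm] finite and later controls an inverse matrix. *)
Lemma mulmx_bounded A :
  exists2 K : R, 0 <= K & forall u, cvnorm (A *m u) <= K * cvnorm u.
Proof.
exists (\sum_j cvnorm (col j A)).
  by apply: sumr_ge0 => j _; apply: cvnorm_ge0.
move=> u; have -> : A *m u = \sum_j u j 0 *: col j A.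
  apply/matrixP => a b; rewrite !mxE summxE; apply: eq_bigr => j _.
  by rewrite !mxE (ord1 b) mulrC.
apply: le_trans (cvnorm_sum _) _; rewrite mulr_suml; apply: ler_sum => j _.
rewrite cvnormZ mulrC ler_wpM2l ?cvnorm_ge0 //.
rewrite -(@ler_pXn2r _ 2) ?nnegrE ?cvnorm_ge0 ?normc_ge0 //.
rewrite cvnorm_sqr (bigD1 j) //= lerDl sumr_ge0 // => k _.
exact: sqr_ge0.
Qed.

Lemma opnorm_has_sup A :
  has_sup [set cvnorm (A *m u) | u in @unit_sphere R n.+1].
Proof.
split.
  by have [u hu] := unit_sphere_nonempty; exists (cvnorm (A *m u)); exists u.
have [K K0 H] := mulmx_bounded A; exists K => _ [u hu <-].
by apply: le_trans (H u) _; rewrite hu mulr1.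
Qed.

Lemma opnormP A u : cvnorm (A *m u) <= opnorm A * cvnorm u.
Proof.
have [->|u0] := eqVneq u 0; first by rewrite mulmx0 !cvnorm0 mulr0.
have hu : 0 < cvnorm u by rewrite cvnorm_gt0.
rewrite -ler_pdivrMr //; apply: sup_upper_bound (opnorm_has_sup A) _ _.
exists (((cvnorm u)^-1)%:C%C *: u); first exact: cvnorm_normalize.
rewrite -scalemxAr cvnormZ normc_real mulrC ger0_norm //.
by rewrite invr_ge0 cvnorm_ge0.
Qed.

Lemma opnorm_ge0 A : 0 <= opnorm A.
Proof.
have [u hu] := unit_sphere_nonempty.
apply: le_trans (cvnorm_ge0 (A *m u)) _.
by rewrite -[opnorm A]mulr1 -hu opnormP.
Qed.

Lemma opnorm_le A (K : R) :
  (forall u, cvnorm (A *m u) <= K * cvnorm u) -> opnorm A <= K.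
Proof.
move=> H; apply: ge_sup; first by case: (opnorm_has_sup A).
by move=> _ [u hu <-]; apply: le_trans (H u) _; rewrite hu mulr1.
Qed.

End OperatorNorm.
End HermitianSpace.

(** * Eigenvectors at boundary points of the numerical range, and compressions to hyperplanes *)

Section Kernels.
Variable R : realType.

Lemma num_range_rayleigh N (A : 'M[R[i]]_N) v : v != 0 ->
  num_range A (cinner (A *m v) v / (cvnorm v ^+ 2)%:C%C).
Proof.
move=> v0; exists (((cvnorm v)^-1)%:C%C *: v); first exact: cvnorm_normalize.
rewrite -scalemxAr cinnerZl cinnerZr mulrA.
rewrite -normc_sqr normc_real ger0_norm ?invr_ge0 ?cvnorm_ge0 //.
by rewrite exprVn fmorphV mulrC.
Qed.

(* With [t = |z|^2] the equation determines [z] as a function of [t], and the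
   consistency condition on [t] is a real quadratic equation, solved by the
   intermediate value theorem. *)
Lemma quadratic_solvable (a b : R) (c : R[i]) : 0 < a -> 0 < b ->
  exists2 e : R, 0 < e & forall w : R[i], normc w < e ->
    exists z : R[i], z * a%:C%C + z * z^* * c =
      w * (b%:C%C + z * z^* * a%:C%C).
Proof.
move=> a0 b0; pose s := a + normc c.
have s0 : 0 < s by rewrite ltr_wpDr ?normc_ge0.
pose r := a / (2 * s); have r0 : 0 < r by rewrite divr_gt0 // mulr_gt0.
have rs : r * s = a / 2 by rewrite /r; field; rewrite gt_eqF.
pose e := Num.min 1 (a * r / (2 * b)).
have e0 : 0 < e by rewrite lt_min ltr01 /= divr_gt0 // mulr_gt0.
exists e => // w; rewrite lt_min => /andP[w1 we].
pose al := w * b%:C%C; pose d := w * a%:C%C - c.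
(* Real and imaginary parts of [al + t d] as real polynomials in [t], so that [poly_ivt] applies to
   [g]. *)
pose p := (complex.Re al)%:P + complex.Re d *: 'X : {poly R}.
pose q := (complex.Im al)%:P + complex.Im d *: 'X : {poly R}.
pose g := (a ^+ 2 *: 'X) - (p ^+ 2 + q ^+ 2).
have gE t : g.[t] = a ^+ 2 * t - normc (al + t%:C%C * d) ^+ 2.
  rewrite /g /p /q !hornerE; congr (_ - _).
  case: (al) (d) => a1 a2 [d1 d2] /=.
  rewrite sqr_sqrtr ?addr_ge0 ?sqr_ge0 //; ring.
have al_le : normc al <= a * r / 2.
  rewrite normcM normc_real gtr0_norm //.
  have := ltW we; rewrite ler_pdivlMr ?mulr_gt0 // => h.
  by rewrite ler_pdivlMr // -mulrA (mulrC b).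
have d_le : normc d <= s.
  apply: le_trans (le_normcD _ _) _; rewrite normcN /s lerD2r normcM normc_real.
  by rewrite gtr0_norm // ger_pMl // ltW.
have gs : 0 <= g.[r ^+ 2].
  rewrite gE subr_ge0 -exprMn ler_pXn2r ?nnegrE ?normc_ge0 //; last first.
    exact: mulr_ge0 (ltW a0) (ltW r0).
  apply: le_trans (le_normcD _ _) _; rewrite (normcM _ d) normc_real.
  rewrite ger0_norm ?sqr_ge0 //.
  have : r ^+ 2 * normc d <= r ^+ 2 * s by rewrite ler_wpM2l ?sqr_ge0.
  have -> : r ^+ 2 * s = a * r / 2 by rewrite expr2 -mulrA rs; ring.
  move: al_le; lra.
have g0 : g.[0] <= 0.
  by rewrite gE mulr0 sub0r oppr_le0 sqr_ge0.
have [t /andP[t0 _] /rootP] :=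
  poly_ivt (sqr_ge0 r) (introT andP (conj g0 gs)).
rewrite gE => /eqP; rewrite subr_eq0 => /eqP tE.
have aC : a%:C%C != 0 :> R[i] by rewrite eq_complex /= gt_eqF.
pose z := (al + t%:C%C * d) / a%:C%C; exists z.
have -> : z * z^* = t%:C%C.
  rewrite -normc_sqr normcM normcV expr_div_n -tE normc_real gtr0_norm //.
  by rewrite mulrAC divff ?mul1r // gt_eqF // exprn_gt0.
rewrite /z divfK // /d /al; ring.
Qed.

(** If [y = M^H x] were nonzero, the Rayleigh quotient of [A] at [x + z y] would be [l + (z |y|^2 +
    |z|^2 <M y, y>) / (|x|^2 + |z|^2 |y|^2)]. By [quadratic_solvable] the fraction takes every small
    value [w], so [l] would be interior to the numerical range. *)
Lemma boundary_eigenvector N (A : 'M[R[i]]_N) l (x : 'cV_N) :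
  ~ cinterior (num_range A) l ->
  (A - l%:M) *m x = 0 -> (A - l%:M)^H *m x = 0.
Proof.
move=> intA; set M := A - l%:M => Mx; apply/eqP/negP => /negP.
set y := _ *m x => y0; apply: intA.
have x0 : x != 0 by apply: contra_neq y0 => x0; rewrite /y x0 mulmx0.
have a0 : 0 < cvnorm y ^+ 2 by rewrite exprn_gt0 // cvnorm_gt0.
have b0 : 0 < cvnorm x ^+ 2 by rewrite exprn_gt0 // cvnorm_gt0.
have [e e0 He] := quadratic_solvable (cinner (M *m y) y) a0 b0.
exists e => // w /He [z].
have yx : cinner y x = 0.
  by rewrite cinner_adj adjK Mx -cinner_conj cinner0l conjC0.
have xy : cinner x y = 0 by rewrite -cinner_conj yx conjC0.
set v := x + z *: y.
have Mv : cinner (M *m v) v =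
    z * (cvnorm y ^+ 2)%:C%C + z * z^* * cinner (M *m y) y.
  rewrite mulmxDr Mx add0r -scalemxAr cinnerZl cinnerDr cinnerZr.
  rewrite [cinner _ x]cinner_adj -/y cinner_norm; ring.
have vv : (cvnorm v ^+ 2)%:C%C =
    (cvnorm x ^+ 2)%:C%C + z * z^* * (cvnorm y ^+ 2)%:C%C.
  rewrite -!cinner_norm cinnerDl !cinnerDr !cinnerZl !cinnerZr xy yx; ring.
have v0 : v != 0.
  rewrite -cvnorm_eq0 -sqrf_eq0 gt_eqF // -ltcR vv.
  by rewrite ltr_pwDl ?ltcR // -normc_sqr -rmorphM ler0c mulr_ge0 ?sqr_ge0.
rewrite -Mv -vv => E.
suff -> : w = cinner (A *m v) v / (cvnorm v ^+ 2)%:C%C.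
  exact: num_range_rayleigh.
have vC : (cvnorm v ^+ 2)%:C%C != 0 :> R[i].
  by rewrite eq_complex /= negb_and sqrf_eq0 cvnorm_eq0 v0.
have -> : A *m v = M *m v + l *: v.
  by rewrite /M mulmxBl mul_scalar_mx subrK.
by rewrite cinnerDl cinnerZl cinner_norm E -mulrDl mulfK // subrK.
Qed.

(** Gram-Schmidt applied to a row basis of [kermx G^T], then transposed, since [kermx] is a space of
    row vectors. The dimension is given by an equation so that it can be rewritten before [J], whose
    type depends on it, is introduced. *)
Lemma kernel_onb m N (G : 'M[R[i]]_(m, N)) :
  exists2 k, k = (N - \rank G)%N & exists J : 'M[R[i]]_(N, k),
    [/\ J^H *m J = 1%:M, G *m J = 0 &
        forall v : 'cV_N, G *m v = 0 -> J *m (J^H *m v) = v].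
Proof.
pose K := kermx G^T; exists (\rank K); first by rewrite mxrank_ker mxrank_tr.
pose B := schmidt (row_base K).
have BB : B *m B^H = 1%:M.
  by apply/unitarymxP/schmidt_unitarymx; rewrite rank_leq_col.
have BK : (B :=: K)%MS.
  exact: eqmx_trans (eqmx_schmidt_free (row_base_free _)) (eq_row_base _).
have BTH : (B^T)^H = map_mx Num.conj B by rewrite trmxK.
exists B^T; split.
- apply: (can_inj trmxK); rewrite BTH trmx_mul trmxK trmx1 -BB.
  by rewrite map_trmx.
- have : (B <= K)%MS by rewrite BK.
  by move=> /sub_kermxP /(congr1 trmx); rewrite trmx_mul trmxK trmx0.
- move=> v Gv; have : (v^T <= B)%MS.
    by rewrite BK; apply/sub_kermxP; rewrite -trmx_mul Gv trmx0.
  move=> /submxP [D vD]; apply: (can_inj trmxK).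
  rewrite BTH !trmx_mul trmxK vD -!mulmxA [X in _ *m X]mulmxA.
  by rewrite map_trmx BB mul1mx.
Qed.

(** A nonzero row of [G] cuts out a hyperplane containing the kernel of [G]. Enlarging to this
    hyperplane makes the size exactly [n.+1], whatever the dimension of the kernel. *)
Lemma proper_kernel_isometry m n (G : 'M[R[i]]_(m, n.+2)) : G != 0 ->
  exists2 J : 'M[R[i]]_(n.+2, n.+1), J^H *m J = 1%:M &
    forall v : 'cV_n.+2, G *m v = 0 -> J *m (J^H *m v) = v.
Proof.
move=> G0; have [j gj] : exists j, row j G != 0.
  apply/existsP; apply: contra_neqT G0; rewrite negb_exists => /forallP H.
  apply/row_matrixP => j; rewrite row0; apply/eqP.
  by move: (H j); rewrite negbK.
have [k] := kernel_onb (row j G).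
have -> : \rank (row j G) = 1%N.
  by apply/eqP; rewrite eqn_leq rank_leq_row lt0n mxrank_eq0.
rewrite subn1 => -> [J [JJ _ HJ]]; exists J => // v Gv; apply: HJ.
by rewrite -row_mul Gv row0.
Qed.

(** Only the kernel of [G] is assumed [T]-invariant, not the hyperplane spanned by [J]. The
    induction on [p] stays inside that kernel, where [J^H T J] is conjugate to [T]. *)
Lemma horner_compression n (T G : 'M[R[i]]_n.+2) (J : 'M[R[i]]_(n.+2, n.+1)) p
    (u : 'cV_n.+2) :
  (forall v : 'cV_n.+2, G *m v = 0 -> J *m (J^H *m v) = v) ->
  (forall v : 'cV_n.+2, G *m v = 0 -> G *m (T *m v) = 0) ->
  G *m u = 0 ->
  horner_mx T p *m u = J *m (horner_mx (J^H *m T *m J) p *m (J^H *m u)).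
Proof.
move=> HJ HT; set D := _ *m J.
have DE (v : 'cV_n.+2) : G *m v = 0 -> D *m (J^H *m v) = J^H *m (T *m v).
  by move=> Gv; rewrite /D -!mulmxA (HJ _ Gv).
clearbody D; elim/poly_ind: p u => [|p c IH] u Gu.
  by rewrite !rmorph0 !mul0mx mulmx0.
rewrite !rmorphD !rmorphM /= !horner_mx_X !horner_mx_C.
rewrite -!mulmxE !mulmxDl !mul_scalar_mx mulmxDr -!mulmxA.
by rewrite (IH _ (HT _ Gu)) (DE _ Gu) -scalemxAr (HJ _ Gu).
Qed.

(** The compression [D] has its numerical range inside that of [T], so [p] is admissible for [D] and
    the bound for size [n.+1] applies to [p(D)]. *)
Lemma horner_mx_le_on_proper_kernel n (T G : 'M[R[i]]_n.+2) (C : R) p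
    (u : 'cV_n.+2) :
  G != 0 ->
  (forall v : 'cV_n.+2, G *m v = 0 -> G *m (T *m v) = 0) ->
  (crouzeix_const R n <= C%:E)%E ->
  (forall z, num_range T z -> normc p.[z] <= 1) ->
  G *m u = 0 ->
  cvnorm (horner_mx T p *m u) <= C * cvnorm u.
Proof.
move=> G0 HT HC Hp Gu; have [J JJ HJ] := proper_kernel_isometry G0.
rewrite (horner_compression _ HJ HT Gu) cvnorm_isometry //.
set D := _ *m J.
have DC : opnorm (horner_mx D p) <= C.
  rewrite -lee_fin; apply: le_trans HC; apply: le_trans.
    2: by apply: ereal_sup_ubound; exists D.
  apply: ereal_sup_ubound; exists p => // z [w hw <-]; apply: Hp.
  exists (J *m w); first by rewrite /unit_sphere /= cvnorm_isometry.
  by rewrite /D -!mulmxA [RHS]cinner_adj adjK.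
apply: le_trans (opnormP _ _) _; apply: ler_pM => //.
- exact: opnorm_ge0.
- exact: cvnorm_ge0.
- exact: cvnorm_coisometry.
Qed.

End Kernels.

(** * The orthogonal projection onto the eigenspace *)

Section SpectralSplitting.
Variables (R : realType) (n : nat).
Implicit Types (A M P T : 'M[R[i]]_n.+1) (u v w : 'cV[R[i]]_n.+1).

(** [P = J J^H] for an orthonormal basis [J] of the kernel. The hypothesis gives [M^H J = 0], hence
    [P M = 0]: the range of [M] is orthogonal to its kernel. *)
Lemma kernel_projector M :
  (forall x : 'cV_n.+1, M *m x = 0 -> M^H *m x = 0) ->
  exists P, [/\ M *m P = 0, P *m M = 0, P^H = P,
    (forall v, M *m v = 0 -> P *m v = v) &
    (forall v, cvnorm (P *m v) <= cvnorm v) /\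
    (forall v, cvnorm (v - P *m v) <= cvnorm v)].
Proof.
move=> kerM; have [k _ [J [JJ MJ HJ]]] := kernel_onb M.
have MHJ : M^H *m J = 0.
  apply/matrixP => a b; rewrite mxE.
  have /kerM : M *m col b J = 0 by rewrite colE mulmxA MJ mul0mx.
  by rewrite colE mulmxA -colE => /matrixP /(_ a 0); rewrite !mxE.
pose P := J *m J^H.
have PH : P^H = P by rewrite /P adjM adjK.
have PP : P *m P = P by rewrite /P mulmxA -(mulmxA J) JJ mulmx1.
exists P; split=> //.
- by rewrite /P mulmxA MJ mul0mx.
- rewrite /P -mulmxA.
  have -> : J^H *m M = (M^H *m J)^H by rewrite adjM adjK.
  rewrite MHJ; apply/matrixP => a b; rewrite !mxE big1 // => c _.
  by rewrite !mxE conjC0 mulr0.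
- by move=> v /HJ; rewrite /P mulmxA.
(* A self-adjoint idempotent is a contraction, as [|S v|^2 = <v, S v>]; this serves both [P] and
   [1 - P]. *)
have contr (S : 'M[R[i]]_n.+1) v :
    S^H = S -> S *m S = S -> cvnorm (S *m v) <= cvnorm v.
  move=> SH SS; have [->|Sv0] := eqVneq (S *m v) 0.
    by rewrite cvnorm0 cvnorm_ge0.
  rewrite -(@ler_pM2r _ (cvnorm (S *m v))) ?cvnorm_gt0 // -expr2.
  apply: le_trans (cinner_le v (S *m v)).
  have -> : cinner v (S *m v) = cinner (S *m v) (S *m v).
    by rewrite cinner_adj SH mulmxA SS.
  by rewrite cinner_norm normc_real ger0_norm // sqr_ge0.
split=> v; first exact: contr.
have -> : v - P *m v = (1%:M - P) *m v by rewrite mulmxBl mul1mx.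
apply: contr.
  rewrite -[X in _ = _ - X]PH; apply/matrixP => a b.
  by rewrite !mxE rmorphB rmorph_nat eq_sym.
by rewrite mulmxBl !mulmxBr !mul1mx mulmx1 PP subrr subr0.
Qed.

(** [M + P] is invertible and sends [v - P v] to [M v], so [K] can be any bound for its inverse. *)
Lemma complement_bounded M P :
  M *m P = 0 -> P *m M = 0 -> (forall v, M *m v = 0 -> P *m v = v) ->
  exists2 K : R, 0 <= K & forall v, cvnorm (v - P *m v) <= K * cvnorm (M *m v).
Proof.
move=> MP PM kerP.
have PP v : P *m (P *m v) = P *m v by apply: kerP; rewrite mulmxA MP mul0mx.
have inj v : (M + P) *m v = 0 -> v = 0.
  rewrite mulmxDl => H; have Pv : P *m v = 0.
    have := congr1 (mulmx P) H.
    by rewrite mulmxDr mulmxA PM mul0mx add0r PP mulmx0.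
  by rewrite -[v]kerP // -[RHS]H Pv addr0.
have unitS : M + P \in unitmx.
  rewrite -unitmx_tr -row_free_unit -kermx_eq0; apply/eqP/row_matrixP => j.
  rewrite row0; apply: (can_inj trmxK); rewrite trmx0; apply: inj.
  have := congr1 (row j) (mulmx_ker (M + P)^T).
  by rewrite row_mul row0 => /(congr1 trmx); rewrite trmx_mul trmxK trmx0.
have [K K0 HK] := mulmx_bounded (invmx (M + P)); exists K => // v.
rewrite -[v - _](mulKmx unitS); apply: le_trans (HK _) _.
have -> // : (M + P) *m (v - P *m v) = M *m v.
by rewrite mulmxBr !mulmxDl PP !mulmxA MP mul0mx add0r addrK.
Qed.

Lemma horner_prod_cons T (a : R[i]) s v :
  horner_mx T (\prod_(z <- a :: s) ('X - z%:P)) *m v =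
  horner_mx T (\prod_(z <- s) ('X - z%:P)) *m (T *m v - a *: v).
Proof.
rewrite big_cons mulrC rmorphM rmorphB /= horner_mx_X horner_mx_C -mulmxE.
by rewrite -mulmxA mulmxBl mul_scalar_mx.
Qed.

(** * Perturbation estimates on kernels of products of linear factors *)

Section Splitting.
Variables (A P : 'M[R[i]]_n.+1) (l : R[i]) (K m : R).
Let M := A - l%:M.
Hypothesis PM : P *m M = 0.
Hypothesis P_contr : forall v, cvnorm (P *m v) <= cvnorm v.
Hypothesis Q_contr : forall v, cvnorm (v - P *m v) <= cvnorm v.
Hypothesis K0 : 0 <= K.
Hypothesis HK : forall v, cvnorm (v - P *m v) <= K * cvnorm (M *m v).
Hypothesis m0 : 0 <= m.
Hypothesis Hm : forall v, cvnorm (M *m v) <= m * cvnorm v.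

Lemma shift_decomp T (a : R[i]) v :
  T *m v - a *: v = M *m v + (T - A) *m v + (l - a) *: v.
Proof.
rewrite /M !mulmxBl mul_scalar_mx scalerBl.
move: (T *m v) (A *m v) (l *: v) (a *: v) => x y z t.
by apply/matrixP=> b c; rewrite !mxE; ring.
Qed.

Lemma shift_norm T (a : R[i]) (d : R) v :
  cvnorm ((T - A) *m v) <= d * cvnorm v ->
  cvnorm (T *m v - a *: v) <= (m + d + normc (l - a)) * cvnorm v.
Proof.
move=> h; rewrite shift_decomp !mulrDl.
apply: le_trans (cvnormD _ _) _; apply: lerD; last by rewrite cvnormZ.
by apply: le_trans (cvnormD _ _) _; apply: lerD.
Qed.

(** Induction on the number of factors: [w = (T - a) v] is killed by the remaining ones, so
    [w - P w] is small; this makes [M v] small, and [HK] concludes. The constant [B] depends on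
    neither [T] nor the roots. *)
Lemma near_roots_decay k : exists2 B : R, 0 <= B &
  forall T (s : seq R[i]) (d : R), (size s <= k)%N -> 0 <= d <= 1 ->
    (forall v, cvnorm ((T - A) *m v) <= d * cvnorm v) ->
    {in s, forall z, normc (l - z) <= d} ->
    forall v, horner_mx T (\prod_(z <- s) ('X - z%:P)) *m v = 0 ->
    cvnorm (v - P *m v) <= B * d * cvnorm v.
Proof.
elim: k => [|k [B B0 IH]].
  exists 0 => // T [|//] d _ _ _ _ v.
  rewrite big_nil rmorph1 mul1mx => ->.
  by rewrite mulmx0 subr0 cvnorm0 mulr0.
(* [m + 2] bounds [|w| / |v|]; the last 2 counts the perturbation term and the term in [l - a], each
   at most [d |v|]. *)
exists (K * (B * (m + 2) + 2)).
  by rewrite mulr_ge0 // addr_ge0 // mulr_ge0 // addr_ge0.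
move=> T [|a s] d sk d01 Td sd v.
  rewrite big_nil rmorph1 mul1mx => ->.
  by rewrite mulmx0 subr0 cvnorm0 mulr0.
have /andP[d0 d1] := d01.
rewrite horner_prod_cons; set w := T *m v - _ => Hw.
have ad : normc (l - a) <= d by apply: sd; rewrite mem_head.
have {Hw} Qw : cvnorm (w - P *m w) <= B * d * cvnorm w.
  by apply: (IH T s) => // z zs; apply: sd; rewrite inE zs orbT.
have w_le : cvnorm w <= (m + 2) * cvnorm v.
  apply: le_trans (shift_norm _ (Td v)) _.
  by rewrite ler_wpM2r ?cvnorm_ge0 //; lra.
(* [1 - P] applied to [shift_decomp]; it fixes [M v] because [P M = 0]. *)
have Mv : M *m v = (w - P *m w) - ((T - A) *m v - P *m ((T - A) *m v))
    - (l - a) *: (v - P *m v).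
  rewrite /w shift_decomp; set x := (T - A) *m v; set y := M *m v.
  have Py : P *m y = 0 by rewrite /y mulmxA PM mul0mx.
  rewrite !mulmxDr Py add0r -scalemxAr scalerBr.
  set z := (l - a) *: v; set z' := (l - a) *: (P *m v); set x' := P *m x.
  by clearbody x y z z' x'; apply/matrixP=> b c; rewrite !mxE; ring.
apply: le_trans (HK v) _; rewrite -!mulrA ler_wpM2l //.
rewrite Mv; apply: le_trans (cvnormB _ _) _.
have h1 := le_trans (cvnormB (w - P *m w) _) (lerD Qw (Q_contr ((T - A) *m v))).
apply: le_trans (lerD h1 (lexx _)) _; rewrite cvnormZ.
have h2 : normc (l - a) * cvnorm (v - P *m v) <= d * cvnorm v.
  by rewrite ler_pM ?normc_ge0 ?cvnorm_ge0.
have h3 : B * d * cvnorm w <= B * d * ((m + 2) * cvnorm v).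
  by rewrite ler_wpM2l // mulr_ge0.
apply: le_trans (lerD (lerD h3 (Td v)) h2) _.
by rewrite le_eqVlt; apply/orP; left; apply/eqP; ring.
Qed.

(** Here [P] is applied to [w = (T - a) v]: it kills [M v], so [(l - a) P v] is small, and one
    divides by [r = |l - a| >= e]. The bound on [|w|] grows with [r], but after the division it
    becomes [(m + 1) / r + 1], so [B] is uniform however far the root lies. *)
Lemma far_roots_decay (e : R) k : 0 < e -> exists2 B : R, 0 <= B &
  forall T (s : seq R[i]) (d : R), (size s <= k)%N -> 0 <= d <= 1 ->
    (forall v, cvnorm ((T - A) *m v) <= d * cvnorm v) ->
    {in s, forall z, e <= normc (l - z)} ->
    forall v, horner_mx T (\prod_(z <- s) ('X - z%:P)) *m v = 0 ->
    cvnorm (P *m v) <= B * d * cvnorm v.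
Proof.
move=> e0; elim: k => [|k [B B0 IH]].
  exists 0 => // T [|//] d _ _ _ _ v.
  rewrite big_nil rmorph1 mul1mx => ->.
  by rewrite mulmx0 cvnorm0 mulr0.
exists (B * ((m + 1) / e + 1) + e^-1).
  rewrite addr_ge0 ?invr_ge0 ?(ltW e0) //.
  by rewrite mulr_ge0 // addr_ge0 // divr_ge0 ?(ltW e0) // addr_ge0.
move=> T [|a s] d sk d01 Td sd v.
  rewrite big_nil rmorph1 mul1mx => ->.
  by rewrite mulmx0 cvnorm0 mulr0.
have /andP[d0 d1] := d01.
rewrite horner_prod_cons; set w := T *m v - _ => Hw.
have ea : e <= normc (l - a) by apply: sd; rewrite mem_head.
have {Hw} Pw : cvnorm (P *m w) <= B * d * cvnorm w.
  by apply: (IH T s) => // z zs; apply: sd; rewrite inE zs orbT.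
have w_le := shift_norm a (Td v); rewrite -/w in w_le.
set r := normc (l - a) in ea w_le *.
have r0 : 0 < r by apply: lt_le_trans ea.
have Pv : (l - a) *: (P *m v) = P *m w - P *m ((T - A) *m v).
  rewrite /w shift_decomp !mulmxDr mulmxA PM mul0mx add0r -scalemxAr.
  by rewrite addrAC subrr add0r.
have : r * cvnorm (P *m v) <= B * d * ((m + 1 + r) * cvnorm v) + d * cvnorm v.
  rewrite /r -cvnormZ Pv; apply: le_trans (cvnormB _ _) _; apply: lerD.
    apply: le_trans Pw _; rewrite ler_wpM2l ?mulr_ge0 //.
    apply: le_trans w_le _; rewrite ler_wpM2r ?cvnorm_ge0 // -/r; lra.
  exact: le_trans (P_contr _) (Td v).
rewrite mulrC -ler_pdivlMr // => /le_trans; apply.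
have -> : (B * d * ((m + 1 + r) * cvnorm v) + d * cvnorm v) / r =
  (B * ((m + 1) / r + 1) + r^-1) * d * cvnorm v.
  by field; rewrite gt_eqF.
rewrite ler_wpM2r ?cvnorm_ge0 // ler_wpM2r //.
have ie : r^-1 <= e^-1 by rewrite lef_pV2 ?posrE.
by rewrite lerD // ler_wpM2l // lerD2r ler_wpM2l // addr_ge0.
Qed.

End Splitting.
End SpectralSplitting.

(** * Almost orthogonal invariant subspaces of matrices near [A], and the resulting norm bound *)

Section NearScalarSpectrum.
Variables (R : realType) (n : nat).
Implicit Types (A T : 'M[R[i]]_n.+2) (u v x : 'cV[R[i]]_n.+2).

Lemma prod_XsubC_coprime (F : closedFieldType) (s : seq F) (a : pred F) :
  coprimep (\prod_(z <- [seq z <- s | a z]) ('X - z%:P))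
           (\prod_(z <- [seq z <- s | predC a z]) ('X - z%:P)).
Proof.
apply: Pdiv.ClosedField.root_coprimep => z; rewrite root_prod_XsubC mem_filter.
move=> /andP[az _]; apply/negP => /rootP/rootP.
by rewrite root_prod_XsubC mem_filter /= az.
Qed.

Lemma horner_stable_kernel T (p : {poly R[i]}) v :
  horner_mx T p *m v = 0 -> horner_mx T p *m (T *m v) = 0.
Proof.
move=> pv; have E : horner_mx T p *m T = T *m horner_mx T p.
  by have := comm_horner_mx p (erefl (T *m T)).
by rewrite mulmxA E -mulmxA pv mulmx0.
Qed.

(** [G1 = q(T)] and [G2 = r(T)], where [char_poly T = q r] and [q] collects the roots within [d1] of
    [l]. *)
Lemma spectral_splitting A (l : R[i]) (e : R) : 0 < e < 1 ->
  (exists2 x : 'cV_n.+2, x != 0 & (A - l%:M) *m x = 0) ->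
  (A - l%:M) != 0 ->
  (forall x : 'cV_n.+2, (A - l%:M) *m x = 0 -> (A - l%:M)^H *m x = 0) ->
  exists2 d : R, 0 < d & forall T, opnorm (T - A) <= d ->
    exists G1 G2 : 'M[R[i]]_n.+2,
    [/\ G1 != 0, G2 != 0,
        (forall v, G1 *m v = 0 -> G1 *m (T *m v) = 0) /\
        (forall v, G2 *m v = 0 -> G2 *m (T *m v) = 0),
        (forall x, exists u v : 'cV_n.+2,
           [/\ x = u + v, G1 *m u = 0 & G2 *m v = 0]) &
        (forall u v, G1 *m u = 0 -> G2 *m v = 0 ->
           normc (cinner u v) <= 2 * e * cvnorm u * cvnorm v)].
Proof.
move=> /andP[e0 e1] [x1 x1n0 Mx1] M0 kerM; set M := A - l%:M in Mx1 M0 kerM *.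
have [P [MP PM PH kerP [P_contr Q_contr]]] := kernel_projector kerM.
have [K K0 HK] := complement_bounded MP PM kerP.
have [m m0 Hm] := mulmx_bounded M.
(* A nonzero column of [M] works since [P M = 0]. Later [x2] shows [q(T) != 0] and [x1] shows
   [r(T) != 0]. *)
have [x2 x2n0 Px2] : exists2 x : 'cV[R[i]]_n.+2, x != 0 & P *m x = 0.
  have [j Mj] : exists j, col j M != 0.
    apply/existsP; apply: contra_neqT M0; rewrite negb_exists => /forallP H.
    apply/matrixP => a b; move: (H b); rewrite negbK => /eqP /matrixP /(_ a 0).
    by rewrite !mxE.
  by exists (col j M) => //; rewrite colE mulmxA PM mul0mx.
(* Order of choices: [B1] fixes the radius [d1], which separates near from far roots; [B2] depends
   on [d1]; only then is [d <= d1] chosen. The near estimate is used with parameter [d1], the far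
   one with [d]. *)
have [B1 B10 near] := near_roots_decay PM Q_contr K0 HK m0 Hm n.+2.
pose d1 : R := Num.min 1 (e / (B1 + 1)).
have d10 : 0 < d1 by rewrite lt_min ltr01 /= divr_gt0 // ltr_wpDl.
have [B2 B20 far] := far_roots_decay PM P_contr m0 Hm n.+2 d10.
pose d : R := Num.min d1 (e / (B2 + 1)).
have d0 : 0 < d by rewrite lt_min d10 /= divr_gt0 // ltr_wpDl.
have dd1 : d <= d1 by rewrite ge_min lexx.
have d11 : d1 <= 1 by rewrite ge_min lexx.
have B1e : B1 * d1 <= e.
  apply: (@le_trans _ _ ((B1 + 1) * d1)).
    by rewrite ler_wpM2r ?ltW // ltrDl.
  by rewrite mulrC -ler_pdivlMr ?ltr_wpDl // ge_min lexx orbT.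
have B2e : B2 * d <= e.
  apply: (@le_trans _ _ ((B2 + 1) * d)).
    by rewrite ler_wpM2r ?ltW // ltrDl.
  by rewrite mulrC -ler_pdivlMr ?ltr_wpDl // ge_min lexx orbT.
exists d => // T Td.
have TdE (t : R) : d <= t -> forall v, cvnorm ((T - A) *m v) <= t * cvnorm v.
  move=> dt v; apply: le_trans (opnormP _ _) _.
  by rewrite ler_wpM2r ?cvnorm_ge0 // (le_trans Td).
have [s Hs] := closed_field_poly_normal (char_poly T).
rewrite (monicP (char_poly_monic T)) scale1r in Hs.
have sz : size s = n.+2.
  have := size_char_poly T; rewrite Hs size_prod_XsubC; by case.
pose a := [pred z : R[i] | normc (l - z) <= d1].
set q := \prod_(z <- [seq z <- s | a z]) ('X - z%:P).
set r := \prod_(z <- [seq z <- s | predC a z]) ('X - z%:P).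
have qr : horner_mx T (q * r) = 0.
  rewrite -(Cayley_Hamilton T) Hs /q /r !big_filter.
  by rewrite [in RHS](bigID a) /=.
(* From [b q + c r = 1], [x = (c r)(T) x + (b q)(T) x]; by Cayley-Hamilton [q(T)] kills the first
   term and [r(T)] the second. *)
have /Bezout_eq1_coprimepP [[b c] /= bc] := prod_XsubC_coprime s a.
rewrite -/q -/r in bc.
have nearq u : horner_mx T q *m u = 0 -> cvnorm (u - P *m u) <= e * cvnorm u.
  move=> qu; apply: le_trans (near T _ d1 _ _ _ _ u qu) _.
  - by rewrite size_filter -sz count_size.
  - by rewrite ltW.
  - exact: TdE.
  - by move=> z; rewrite mem_filter => /andP[].
  - by rewrite ler_wpM2r ?cvnorm_ge0.
have farr v : horner_mx T r *m v = 0 -> cvnorm (P *m v) <= e * cvnorm v.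
  move=> rv; apply: le_trans (far T _ d _ _ _ _ v rv) _.
  - by rewrite size_filter -sz count_size.
  - by rewrite ltW // (le_trans dd1).
  - exact: TdE.
  - move=> z; rewrite mem_filter => /andP[/= /negP H _].
    by rewrite leNgt; apply/negP => h; apply: H; rewrite ltW.
  - by rewrite ler_wpM2r ?cvnorm_ge0.
exists (horner_mx T q), (horner_mx T r); split.
(* If [q(T)] vanished, the near estimate at [x2] would read [|x2| <= e |x2|] with [e < 1]. *)
- apply/eqP => q0; have := nearq x2; rewrite q0 mul0mx Px2 subr0 => /(_ erefl).
  by rewrite leNgt gtr_pMl ?cvnorm_gt0 // e1.
- apply/eqP => r0; have := farr x1; rewrite r0 mul0mx kerP // => /(_ erefl).
  by rewrite leNgt gtr_pMl ?cvnorm_gt0 // e1.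
- by split=> v; apply: horner_stable_kernel.
- move=> x; exists (horner_mx T (c * r) *m x), (horner_mx T (b * q) *m x).
  split.
  + by rewrite -mulmxDl -rmorphD addrC bc rmorph1 mul1mx.
  + by rewrite mulmxA mulmxE -rmorphM mulrCA rmorphM /= qr mulr0 mul0mx.
  + rewrite mulmxA mulmxE -rmorphM mulrCA (mulrC r) rmorphM /= qr.
    by rewrite mulr0 mul0mx.
- move=> u v qu rv.
  (* Self-adjointness of [P] moves it onto [v]; each summand is then at most [e |u| |v|]. *)
  have -> : cinner u v = cinner (u - P *m u) v + cinner u (P *m v).
    by rewrite -{2}PH -cinner_adj -cinnerDl subrK.
  apply: le_trans (le_normcD _ _) _.
  apply: le_trans (lerD (cinner_le _ _) (cinner_le _ _)) _.
  have h1 := ler_wpM2r (cvnorm_ge0 v) (nearq u qu).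
  have h2 := ler_wpM2l (cvnorm_ge0 u) (farr v rv).
  apply: le_trans (lerD h1 h2) _.
  by rewrite le_eqVlt; apply/orP; left; apply/eqP; ring.
Qed.

(** Approximate Pythagoras: the cross term [2 Re <u, v>] is at most
    [2 e |u| |v| <= e (|u|^2 + |v|^2)] in modulus. *)
Lemma cvnormD_sqr u v (e : R) :
  normc (cinner u v) <= e * cvnorm u * cvnorm v -> 0 <= e ->
  (1 - e) * (cvnorm u ^+ 2 + cvnorm v ^+ 2) <= cvnorm (u + v) ^+ 2 <=
  (1 + e) * (cvnorm u ^+ 2 + cvnorm v ^+ 2).
Proof.
move=> uv e0.
have E : cvnorm (u + v) ^+ 2 =
    cvnorm u ^+ 2 + cvnorm v ^+ 2 + 2 * complex.Re (cinner u v).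
  apply: complexI; rewrite -cinner_norm cinnerDl !cinnerDr !cinner_norm.
  have -> : cinner v u = (cinner u v)^* by rewrite cinner_conj.
  case: (cinner u v) => a b.
  by apply/eqP; rewrite eq_complex /=; apply/andP; split; apply/eqP; ring.
have : `|complex.Re (cinner u v)| <= e * cvnorm u * cvnorm v.
  apply: le_trans uv; case: (cinner u v) => a b /=.
  by rewrite -sqrtr_sqr ler_wsqrtr // lerDl sqr_ge0.
rewrite E ler_norml => /andP[h1 h2].
have h3 : e * (2 * (cvnorm u * cvnorm v)) <=
    e * (cvnorm u ^+ 2 + cvnorm v ^+ 2).
  rewrite ler_wpM2l //.
  have := sqr_ge0 (cvnorm u - cvnorm v); rewrite sqrrB -mulr_natl; lra.
apply/andP; split; move: h1 h2 h3; rewrite -!mulrA; lra.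
Qed.

(** For [x = u + v] split along the two kernels, approximate Pythagoras for [p(T) u, p(T) v] and for
    [u, v] gives [|p(T) x|^2 <= C^2 |x|^2 (1 + 2 e) / (1 - 2 e)]. *)
Lemma opnorm_horner_near A (l : R[i]) (C rho : R) : 0 < rho <= 1 -> 0 <= C ->
  (crouzeix_const R n <= C%:E)%E ->
  (exists2 x : 'cV_n.+2, x != 0 & (A - l%:M) *m x = 0) ->
  (A - l%:M) != 0 ->
  (forall x : 'cV_n.+2, (A - l%:M) *m x = 0 -> (A - l%:M)^H *m x = 0) ->
  exists2 d : R, 0 < d & forall T p, opnorm (T - A) <= d ->
    (forall z, num_range T z -> normc p.[z] <= 1) ->
    opnorm (horner_mx T p) <= (1 + rho) * C.
Proof.
move=> /andP[rho0 rho1] C0 HC hx M0 kerM.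
(* Small enough that [(1 + 2 e) / (1 - 2 e) <= (1 + rho)^2], which is [key] below. *)
pose e := rho / 10; have e0 : 0 < e by rewrite divr_gt0.
have e1 : e <= 1 / 10 by rewrite ler_pM2r.
have e01 : 0 < e < 1 by rewrite e0 /=; lra.
have [d d0 Hd] := spectral_splitting e01 hx M0 kerM.
exists d => // T p /Hd [G1 [G2 [G10 G20 [st1 st2] dec orth]]] Hp.
have b1 u := horner_mx_le_on_proper_kernel G10 st1 HC Hp (u := u).
have b2 u := horner_mx_le_on_proper_kernel G20 st2 HC Hp (u := u).
(* The kernels are also invariant under [p(T)], so the images of [u] and [v] are again almost
   orthogonal. *)
have stp G (q : {poly R[i]}) : (forall v, G *m v = 0 -> G *m (T *m v) = 0) ->
    forall v : 'cV_n.+2, G *m v = 0 -> G *m (horner_mx T q *m v) = 0.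
  move=> st; elim/poly_ind: q => [|q c IH] v Gv.
    by rewrite rmorph0 mul0mx mulmx0.
  rewrite rmorphD rmorphM /= horner_mx_X horner_mx_C -mulmxE mulmxDl -mulmxA.
  by rewrite mulmxDr (IH _ (st _ Gv)) mul_scalar_mx -scalemxAr Gv scaler0 addr0.
apply: opnorm_le => x; have [u [v [-> Gu Gv]]] := dec x.
rewrite -(@ler_pXn2r _ 2) ?nnegrE ?mulr_ge0 ?cvnorm_ge0 ?addr_ge0 //;
  last exact: ltW.
have ee0 : 0 <= 2 * e by rewrite mulr_ge0 // ltW.
have /andP[low _] := cvnormD_sqr (orth _ _ Gu Gv) ee0.
have orthp := orth _ _ (stp _ _ p st1 _ Gu) (stp _ _ p st2 _ Gv).
have /andP[_ up] := cvnormD_sqr orthp ee0.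
rewrite mulmxDr; apply: le_trans up _.
have s1 : cvnorm (horner_mx T p *m u) ^+ 2 <= C ^+ 2 * cvnorm u ^+ 2.
  by rewrite -exprMn ler_pXn2r ?nnegrE ?mulr_ge0 ?cvnorm_ge0 // b1.
have s2 : cvnorm (horner_mx T p *m v) ^+ 2 <= C ^+ 2 * cvnorm v ^+ 2.
  by rewrite -exprMn ler_pXn2r ?nnegrE ?mulr_ge0 ?cvnorm_ge0 // b2.
set S := cvnorm u ^+ 2 + cvnorm v ^+ 2 in low *.
have S0 : 0 <= S by rewrite addr_ge0 ?sqr_ge0.
apply: (@le_trans _ _ ((1 + 2 * e) * (C ^+ 2 * S))).
  by rewrite ler_wpM2l ?addr_ge0 // /S mulrDr lerD.
have key : 1 + 2 * e <= (1 + rho) ^+ 2 * (1 - 2 * e).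
  have -> : rho = 10 * e by rewrite /e; field.
  nra.
rewrite !exprMn.
apply: (@le_trans _ _ ((1 + rho) ^+ 2 * (1 - 2 * e) * (C ^+ 2 * S))).
  by rewrite ler_wpM2r // mulr_ge0 // sqr_ge0.
have -> : (1 + rho) ^+ 2 * (1 - 2 * e) * (C ^+ 2 * S) =
  (1 + rho) ^+ 2 * C ^+ 2 * ((1 - 2 * e) * S) by ring.
by rewrite ler_wpM2l // mulr_ge0 // sqr_ge0.
Qed.

End NearScalarSpectrum.

(** * Passage to the upper limit *)

Lemma singular_kernel (R : realType) n (M : 'M[R[i]]_n) : M \notin unitmx ->
  exists2 x : 'cV_n, x != 0 & M *m x = 0.
Proof.
rewrite -unitmx_tr unitmxE unitfE negbK => /det0P [v v0 vM].
exists v^T; first by rewrite trmx_eq0.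
by apply: (can_inj trmxK); rewrite trmx_mul trmxK vM trmx0.
Qed.

(** Witnessed by the zero matrix and the zero polynomial. It excludes the value [-oo] and makes a
    finite [C] nonnegative. *)
Lemma crouzeix_const_ge0 (R : realType) n : (0 <= crouzeix_const R n)%E.
Proof.
apply: (@le_trans _ _ (crouzeix_ratio (0 : 'M[R[i]]_n.+1))); last first.
  by apply: ereal_sup_ubound; exists 0.
apply: (@le_trans _ _ (opnorm (horner_mx (0 : 'M[R[i]]_n.+1) 0))%:E).
  by rewrite lee_fin opnorm_ge0.
by apply: ereal_sup_ubound; exists 0 => // z _; rewrite horner0 normc0.
Qed.

Unset Implicit Arguments.
(* N = n.+2 >= 2; C_{N-1} = crouzeix_const R n (matrices of size n.+1 = N-1). *)
Theorem theorem3p1 (R : realType) (n : nat) (A : 'M[R[i]]_n.+2)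
    (A_ : nat -> 'M[R[i]]_n.+2) :
  ~ (exists c : R[i], A = c%:M) ->
  spectrum A `&` cboundary (num_range A) !=set0 ->
  (fun k => opnorm (A_ k - A)) @ \oo --> (0 : R) ->
  (limn_esup (fun k => crouzeix_ratio (A_ k)) <= crouzeix_const R n)%E.
Proof.
move=> notscalar [l [/singular_kernel ker_ex [_ nint]]] cvA.
have := crouzeix_const_ge0 R n.
case HC : (crouzeix_const R n) => [C| |] //; last by move=> _; rewrite leey.
rewrite lee_fin => C0.
have M0 : A - l%:M != 0.
  by apply/eqP => /subr0_eq E; apply: notscalar; exists l.
have kerM x := @boundary_eigenvector R n.+2 A l x nint.
apply/lee_addgt0Pr => e e0.
(* Chosen so that [(1 + rho) C <= C + e]; dividing by [C + 1] covers [C = 0]. *)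
pose rho : R := Num.min 1 (e / (C + 1)).
have C1 : 0 < C + 1 by rewrite ltr_wpDl.
have rho0 : 0 < rho by rewrite lt_min ltr01 /= divr_gt0.
have rho01 : 0 < rho <= 1 by rewrite rho0 ge_min lexx.
have rhoC : (1 + rho) * C <= C + e.
  rewrite mulrDl mul1r lerD2l.
  apply: (@le_trans _ _ (rho * (C + 1))).
    by rewrite ler_wpM2l ?lerDl ?(ltW rho0).
  by rewrite -ler_pdivlMr // ge_min lexx orbT.
have HC' : (crouzeix_const R n <= C%:E)%E by rewrite HC.
have [d d0 Hd] := opnorm_horner_near rho01 C0 HC' ker_ex M0 kerM.
(* The upper limit is an infimum of suprema over the sets of the filter, so one set suffices: the
   indices [k] with [A_ k] within [d] of [A]. *)
rewrite /limn_esup limf_esupE.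
apply: (@le_trans _ _
    (ereal_sup [set crouzeix_ratio (A_ k) |
                k in [set k | opnorm (A_ k - A) <= d]])).
  apply: ereal_inf_lbound; exists [set k | opnorm (A_ k - A) <= d] => //.
  have /cvgrPdist_le /(_ d d0) := cvA.
  apply: filterS => k /=; rewrite sub0r normrN; exact/le_trans/ler_norm.
apply: ge_ereal_sup => _ [k /= kd <-].
apply: ge_ereal_sup => _ [p /= Hp <-].
by rewrite -EFinD lee_fin; apply: le_trans rhoC; apply: Hd.
Qed.
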